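(* Let $f$ and $g$ be two positive integrable functions on $[0,\infty)$, let $x>0$, let $p_1\in(0,1]$, and let $\alpha\in(n,n+1]$ for some $n\in\{0,1,2,\dots\}$. Assume that there exist four positive integrable functions $v_1,v_2,w_1,w_2$ such that $0<v_1(\tau)\le f(\tau)\le v_2(\tau)$ and $0<w_1(\tau)\le g(\tau)\le w_2(\tau)$ for all $\tau\in[0,x]$. Put $a=\frac{p_1-1}{p_1}$ and $$S(x)=\frac{1}{p_1^{\alpha}\Gamma(\alpha)}\sum_{k_1=0}^{\infty}\frac{a^{k_1}}{k_1!}\frac{x^{\alpha+k_1}}{\alpha+k_1}.$$ Then $$\Big|S(x)\,I^{\alpha,p_1}[fg](x)-I^{\alpha,p_1}[f](x)\,I^{\alpha,p_1}[g](x)\Big|\le\big|A(f,v_1,v_2)(x)\,A(g,w_1,w_2)(x)\big|^{1/2},$$ where $$A(u,v,w)(x)=S(x)\,\frac{\big(I^{\alpha,p_1}[(v+w)u](x)\big)^2}{4\,I^{\alpha,p_1}[vw](x)}-\big(I^{\alpha,p_1}[u](x)\big)^2 .$$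
   Context: For $\alpha>0$, $p\in(0,1]$ and $x>0$, the (left, based at $0$) generalized proportional fractional (GPF) integral operator is $$I^{\alpha,p}[h](x)=\frac{1}{p^{\alpha}\Gamma(\alpha)}\int_0^x e^{\frac{p-1}{p}(x-\tau)}(x-\tau)^{\alpha-1}h(\tau)\,d\tau ,$$ where $\Gamma$ is the Gamma function. All fractional integrals written in the statement are understood to exist as finite numbers. In the power series, $0^0=1$. *)

(* Defs.v *)
From mathcomp Require Import all_boot all_order all_algebra.
From mathcomp Require Import all_classical all_reals all_analysis.

Set Implicit Arguments.
Unset Strict Implicit.
Unset Printing Implicit Defensive.

Import Order.TTheory GRing.Theory Num.Theory.
Import numFieldNormedType.Exports.

Local Open Scope classical_set_scope.
Local Open Scope ring_scope.

Definition pos_integrable (R : realType) (h : R -> R) : Prop :=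
  (forall t, 0 <= t -> 0 < h t) /\
  (@lebesgue_measure R).-integrable `[0, +oo[ (EFin \o h).

Definition Gamma (R : realType) (s : R) : R :=
  \int[@lebesgue_measure R]_(t in `]0, +oo[) (t `^ (s - 1) * expR (- t)).

Definition gpf_integrand (R : realType) (alpha p : R) (h : R -> R) (x t : R) : R :=
  expR ((p - 1) / p * (x - t)) * (x - t) `^ (alpha - 1) * h t.

(* [Rintegral] is a total function: [gpf_int] below is the mathematical integral
   only when this predicate holds. *)
Definition gpf_integrable (R : realType) (alpha p : R) (h : R -> R) (x : R) : Prop :=
  (@lebesgue_measure R).-integrable `[0, x] (EFin \o gpf_integrand alpha p h x).

Definition gpf_int (R : realType) (alpha p : R) (h : R -> R) (x : R) : R :=
  (p `^ alpha * Gamma alpha)^-1 *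
  \int[@lebesgue_measure R]_(t in `[0, x]) gpf_integrand alpha p h x t.

Definition gpf_S (R : realType) (alpha p x : R) : R :=
  (p `^ alpha * Gamma alpha)^-1 *
  limn (series (fun k : nat =>
    ((p - 1) / p) ^+ k / k`!%:R * (x `^ (alpha + k%:R) / (alpha + k%:R)))).

Definition gpf_A (R : realType) (alpha p : R) (u v w : R -> R) (x : R) : R :=
  gpf_S alpha p x *
    (gpf_int alpha p (fun t => (v t + w t) * u t) x ^+ 2 /
     (4 * gpf_int alpha p (fun t => v t * w t) x))
  - gpf_int alpha p u x ^+ 2.

(* Main.v *)
Require Import Defs.
From mathcomp Require Import all_boot all_order all_algebra.
From mathcomp Require Import all_classical all_reals all_analysis.
From mathcomp Require Import measurable_realfun ring lra.

Import Order.TTheory GRing.Theory Num.Theory.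
Import numFieldNormedType.Exports.

Local Open Scope classical_set_scope.
Local Open Scope ring_scope.

(** Write [K t = exp (a (x - t)) (x - t)^(alpha - 1)] with [a = (p - 1) / p], and
[c = (p^alpha Gamma(alpha))^-1].  Every fractional integral at [x] is [c] times
an integral against the weight [K] on [[0, x[], and so is [S]: expanding the
exponential and integrating term by term gives [S = c \int K]
([gpf_S_integral]).  The theorem thus becomes a Gruss type inequality
for the finite measure of density [K].

For such a measure, [cov(f, g) = \int K \int K f g - \int K f \int K g] is a
positive semidefinite bilinear form, so
[cov(f, g)^2 <= cov(f, f) cov(g, g)] ([weighted_cov_CauchySchwarz]).
The bound on [cov(f, f)] comes from the inequality of Polya and Szego:
[(f - v) (w - f) >= 0] integrates to
[\int K f^2 + \int K v w <= \int K (v + w) f], and the inequality between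
arithmetic and geometric means then gives
[4 \int K v w \int K f^2 <= (\int K (v + w) f)^2] ([Rintegral_sqr_between]).
Dividing by [4 \int K v w], which is positive, yields
[c^2 cov(f, f) <= A(f, v, w)] ([weighted_cov_le_gpf_A]).

The integral [Gamma(alpha)] is nonnegative, hence so is [c]; in the degenerate
case [c = 0] the left-hand side of the theorem vanishes, and otherwise the two
bounds combine into [(c^2 cov(f, g))^2 <= A(f, v1, v2) A(g, w1, w2)]. *)

(** * Covariance with respect to a weight *)

(** Minimizing over [c], at [c = (l F + m G) / S], leaves the Schur complement
of [S] as a nonnegative form in [(l, m)].  The conclusion is that, scaled by
[S], the matrix of this form has nonnegative diagonal and determinant. *)
Lemma bordered_gram_le (R : realType) (S F G P Q T : R) :
  0 <= S ->
  (forall l m c : R,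
    0 <= l ^+ 2 * P + m ^+ 2 * T + c ^+ 2 * S
         + 2 * (l * m) * Q - 2 * (l * c) * F - 2 * (m * c) * G) ->
  [/\ 0 <= S * P - F * F, 0 <= S * T - G * G &
      (S * Q - F * G) ^+ 2 <= (S * P - F * F) * (S * T - G * G)].
Proof.
move=> S0 pos; have [S_eq0|S_neq0] := eqVneq S 0.
  (* the form is then affine in [c], which forces [F = G = 0] *)
  have affine_ge0 (A B : R) : (forall c, 0 <= A - 2 * c * B) -> B = 0.
    move=> AB; apply/eqP/negPn/negP => B0.
    (* the point where the affine function [A - 2 c B] takes the value -1 *)
    have := AB ((A + 1) / (2 * B)).
    rewrite (_ : _ - _ = - 1); first by rewrite lerNr oppr0 ler10.
    by field.
  have F_eq0 : F = 0.
    by apply: (affine_ge0 P) => c; have := pos 1 0 c; rewrite S_eq0; lra.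
  have G_eq0 : G = 0.
    by apply: (affine_ge0 T) => c; have := pos 0 1 c; rewrite S_eq0; lra.
  by rewrite S_eq0 F_eq0 G_eq0; split; lra.
have {S_neq0}Sp : 0 < S by rewrite lt_def S_neq0.
set X := S * P - F * F; set Z := S * Q - F * G; set Y := S * T - G * G.
have quad (l m : R) : 0 <= l ^+ 2 * X + 2 * (l * m) * Z + m ^+ 2 * Y.
  rewrite (_ : _ + _ = S * (l ^+ 2 * P + m ^+ 2 * T
      + ((l * F + m * G) / S) ^+ 2 * S + 2 * (l * m) * Q
      - 2 * (l * ((l * F + m * G) / S)) * F
      - 2 * (m * ((l * F + m * G) / S)) * G)); last first.
    by rewrite /X /Y /Z; field; rewrite gt_eqF.
  by rewrite mulr_ge0 // ltW.
have X0 : 0 <= X by have := quad 1 0; lra.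
have Y0 : 0 <= Y by have := quad 0 1; lra.
split=> //; have [Y_eq0|Y_neq0] := eqVneq Y 0.
  (* here the form is [Z^2 X - 2 Z^2 (X + 1) = - Z^2 (X + 2)] *)
  have := quad (- Z) (X + 1); rewrite Y_eq0.
  have := sqr_ge0 Z; have := mulr_ge0 X0 (sqr_ge0 Z); nra.
have Yp : 0 < Y by rewrite lt_def Y_neq0.
(* the minimizing direction of the binary form *)
have := quad Y (- Z).
rewrite (_ : _ + _ = Y * (X * Y - Z ^+ 2)); last by ring.
by rewrite pmulr_rge0 // subr_ge0.
Qed.

Section weighted.
Context {d} {T : measurableType d} {R : realType}.
Context {mu : {measure set T -> \bar R}} {D : set T}.
Hypothesis mD : measurable D.
Implicit Types k f g v w : T -> R.
Local Notation integrableR h := (mu.-integrable D (EFin \o h)).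

Lemma Rintegral_gt0 {f} : (0 < mu D)%E -> integrableR f ->
  (forall t, D t -> 0 < f t) -> 0 < \int[mu]_(t in D) f t.
Proof.
move=> muD fi f0.
have f0' t : D t -> 0 <= f t by move=> /f0 /ltW.
rewrite lt_def Rintegral_ge0 // andbT; apply/negP => /eqP If0.
have mf := measurable_int mu fi.
have : (\int[mu]_(t in D) `|(EFin \o f) t| = 0)%E.
  rewrite (eq_integral (EFin \o f)); last first.
    by move=> t; rewrite inE => Dt /=; rewrite ger0_norm // f0'.
  by rewrite -(@fineK _ (integral _ _ _)) ?integrable_fin_num //; congr EFin.
move=> /(ae_eq_integral_abs mu mD mf) [N [mN N0 DN]].
have : (mu D <= mu N)%E.
  apply: le_measure; rewrite ?inE // => t Dt; apply: DN => /= /(_ Dt) [] ft0.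
  by have := f0 _ Dt; rewrite ft0 ltxx.
by rewrite N0 leNgt muD.
Qed.

Definition weighted_cov k f g : R :=
  \int[mu]_(t in D) k t * \int[mu]_(t in D) (k t * (f t * g t))
  - \int[mu]_(t in D) (k t * f t) * \int[mu]_(t in D) (k t * g t).

(** The form of [bordered_gram_le] is here
[\int k (l f + m g - c)^2], with the constant function as third vector. *)
Lemma weighted_cov_CauchySchwarz {k f g} :
  (forall t, D t -> 0 <= k t) ->
  integrableR k ->
  integrableR (fun t => k t * f t) ->
  integrableR (fun t => k t * g t) ->
  integrableR (fun t => k t * (f t * g t)) ->
  integrableR (fun t => k t * (f t * f t)) ->
  integrableR (fun t => k t * (g t * g t)) ->
  [/\ 0 <= weighted_cov k f f, 0 <= weighted_cov k g g &
      weighted_cov k f g ^+ 2 <= weighted_cov k f f * weighted_cov k g g].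
Proof.
move=> k0 ik ikf ikg ikfg ikff ikgg.
apply: bordered_gram_le; first exact: Rintegral_ge0.
move=> l m c.
have iZ r h : integrableR h -> integrableR (fun t => r * h t).
  by move=> ih; have := integrableZl mD r ih.
have iD h1 h2 : integrableR h1 -> integrableR h2 ->
    integrableR (fun t => h1 t + h2 t).
  by move=> ih1 ih2; have := integrableD mD ih1 ih2.
have := @Rintegral_ge0 _ _ _ mu D
  (fun t => k t * (l * f t + m * g t - c) ^+ 2) _.
have -> : \int[mu]_(t in D) (k t * (l * f t + m * g t - c) ^+ 2) =
  \int[mu]_(t in D) (l ^+ 2 * (k t * (f t * f t))
    + (m ^+ 2 * (k t * (g t * g t)) + (c ^+ 2 * k t
    + (2 * (l * m) * (k t * (f t * g t))
    + (- (2 * (l * c)) * (k t * f t) + - (2 * (m * c)) * (k t * g t)))))).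
  by apply: eq_Rintegral => t _; ring.
rewrite !RintegralD ?RintegralZl//; do ?[apply: (iD)|apply: (iZ)] => //.
move=> + ; set a := (X in 0 <= X) => H.
apply: le_trans (H _) _.
  by move=> t Dt; rewrite mulr_ge0 ?sqr_ge0 ?k0.
by rewrite /a; lra.
Qed.

(** The hypotheses make [f^2] at most [(v + w) f], the only dominating function
at hand. *)
Lemma integrable_sqr_between {k f v w} :
  (forall t, D t -> 0 <= k t) ->
  measurable_fun D k -> measurable_fun D f ->
  (forall t, D t -> 0 <= v t /\ v t <= f t /\ f t <= w t) ->
  integrableR (fun t => k t * ((v t + w t) * f t)) ->
  integrableR (fun t => k t * (f t * f t)).
Proof.
move=> k0 mk mf vfw iM; apply: le_integrable iM => //.
  by apply/measurable_EFinP; do !apply: measurable_funM.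
move=> t Dt /=; have [v0 [vf fw]] := vfw _ Dt; rewrite lee_fin.
have f0 : 0 <= f t := le_trans v0 vf.
have w0 : 0 <= w t := le_trans f0 fw.
rewrite !ger0_norm ?mulr_ge0 ?k0 ?addr_ge0//.
rewrite ler_wpM2l ?k0 // ler_wpM2r //.
by rewrite (le_trans fw) // lerDr.
Qed.

(** Polya and Szego: [(f - v) (w - f) >= 0] is [f^2 + v w <= (v + w) f].  Its
integral is [P + V <= M], whence [4 V P <= (P + V)^2 <= M^2]. *)
Lemma Rintegral_sqr_between {k f v w} :
  (forall t, D t -> 0 <= k t) ->
  measurable_fun D k -> measurable_fun D f ->
  (forall t, D t -> 0 <= v t /\ v t <= f t /\ f t <= w t) ->
  integrableR (fun t => k t * ((v t + w t) * f t)) ->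
  integrableR (fun t => k t * (v t * w t)) ->
  4 * \int[mu]_(t in D) (k t * (v t * w t))
    * \int[mu]_(t in D) (k t * (f t * f t))
  <= (\int[mu]_(t in D) (k t * ((v t + w t) * f t))) ^+ 2.
Proof.
move=> k0 mk mf vfw iM iV.
have iff := integrable_sqr_between k0 mk mf vfw iM.
set P := (X in _ * X <= _); set V := (X in 4 * X * _ <= _).
set M := (X in _ <= X ^+ 2).
have P0 : 0 <= P.
  by apply: Rintegral_ge0 => t Dt; rewrite mulr_ge0 ?k0 // -expr2 sqr_ge0.
have V0 : 0 <= V.
  apply: Rintegral_ge0 => t Dt; have [v0 [vf fw]] := vfw _ Dt.
  by rewrite !mulr_ge0 ?k0 // (le_trans v0) // (le_trans vf).
have PVM : P + V <= M.
  rewrite -RintegralD//; apply: le_Rintegral => //.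
    by have := integrableD mD iff iV.
  move=> t Dt; have [v0 [vf fw]] := vfw _ Dt.
  rewrite -mulrDr ler_wpM2l ?k0 // -subr_ge0.
  rewrite (_ : _ - _ = (f t - v t) * (w t - f t)); last by ring.
  by rewrite mulr_ge0 ?subr_ge0.
apply: (@le_trans _ _ ((P + V) ^+ 2)).
  by rewrite -subr_ge0 (_ : _ - _ = (P - V) ^+ 2) ?sqr_ge0 //; ring.
by rewrite ler_pXn2r // nnegrE ?addr_ge0 // (le_trans _ PVM) // addr_ge0.
Qed.

End weighted.

Arguments weighted_cov {d T R} mu D k f g.

(** * The power kernel and its integral *)

Section kernel.
Context {R : realType}.
Notation mu := (@lebesgue_measure R).

Lemma is_derive_powR_sub {x b t : R} : t < x ->
  is_derive t 1 (fun s => (x - s) `^ b) (- (b * (x - t) `^ (b - 1))).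
Proof.
move=> tx; have xt : 0 < x - t by rewrite subr_gt0.
have := @is_derive1_powR R b (x - t) xt => H.
have H2 : is_derive t (1:R) (fun s : R => x - s) (-1).
  by rewrite -[X in is_derive _ _ _ X]sub0r; exact: is_deriveB.
have := @is_derive1_comp R (@powR R ^~ b) (fun s => x - s) t _ _ H H2.
by rewrite mulrN1.
Qed.

(** For [b < 1] the integrand is unbounded near [x], so the fundamental theorem
of calculus applies only on intervals that stop before [x]. *)
Lemma integral_powR_sub_trunc {x b c : R} : 0 < b -> 0 < c -> c < x ->
  (\int[mu]_(t in `[0%R, c]) ((x - t) `^ (b - 1))%:E
   = (x `^ b / b - (x - c) `^ b / b)%:E)%E.
Proof.
move=> b0 c0 cx.
have dF t : t < x ->
    is_derive t 1 (fun s => - ((x - s) `^ b / b)) ((x - t) `^ (b - 1)).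
  move=> tx; have H := is_derive_powR_sub (b := b) tx.
  rewrite (_ : (fun s => _) = (fun s => - b^-1 *: (x - s) `^ b)); last first.
    by apply/funext => s; rewrite /GRing.scale /=; ring.
  rewrite (_ : (x - t) `^ (b - 1) = - b^-1 *: - (b * (x - t) `^ (b - 1))).
    exact: is_deriveZ.
  by rewrite /GRing.scale /=; field; rewrite gt_eqF.
have contF t : t < x -> {for t, continuous (fun s => - ((x - s) `^ b / b))}.
  move=> /dF [dr _]; apply: differentiable_continuous.
  exact/derivable1_diffP.
have contf : {within `[0%R, c], continuous (fun t => (x - t) `^ (b - 1))}.
  apply: continuous_in_subspaceT => t; rewrite inE/= in_itv/= => /andP[_ tc].
  apply: differentiable_continuous; apply/derivable1_diffP.
  by have [] := is_derive_powR_sub (b := b - 1) (le_lt_trans tc cx).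
rewrite (@continuous_FTC2 _ _ (fun s => - ((x - s) `^ b / b)))//.
- by rewrite subr0 -EFinB opprK addrC.
- split.
  + move=> t; rewrite in_itv/= => /andP[_ tc].
    by have [] := dF t (lt_trans tc cx).
  + apply: cvg_at_right_filter; apply: contF; lra.
  + exact: cvg_at_left_filter (contF _ cx).
- move=> t; rewrite in_itv/= => /andP[_ tc].
  by rewrite derive1E; have [_ ->] := dF t (lt_trans tc cx).
Qed.

Lemma measurable_powR_sub (D : set R) (x b : R) :
  measurable_fun D (fun t : R => (x - t) `^ b).
Proof.
apply: (@measurable_funTS _ _ _ _ D); apply: (measurableT_comp (measurable_powR b)).
exact: measurable_funB.
Qed.

Lemma measurable_expR_powR_sub {D : set R} {a x b : R} :
  measurable_fun D (fun t : R => expR (a * (x - t)) * (x - t) `^ b).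
Proof.
apply: measurable_funM; last exact: measurable_powR_sub.
apply: measurable_funTS; apply: (measurableT_comp (@measurable_expR R)).
by apply: measurable_funM => //; exact: measurable_funB.
Qed.

(** Monotone convergence along the intervals [[0, x - x / (i + 2)]]; the shift
by 2 keeps them nondegenerate. *)
Lemma integral_powR_sub {x b : R} : 0 < x -> 0 < b ->
  (\int[mu]_(t in `[0%R, x[) ((x - t) `^ (b - 1))%:E = (x `^ b / b)%:E)%E.
Proof.
move=> x0 b0.
pose c (i : nat) := x - x * i.+2%:R^-1 : R.
have cE i : x - c i = x * i.+2%:R^-1 by rewrite /c; ring.
have xi i : 0 < x * i.+2%:R^-1 by rewrite mulr_gt0 // invr_gt0 ltr0n.
have cx i : c i < x by rewrite -subr_gt0 cE.
have c0 i : 0 < c i.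
  by rewrite /c subr_gt0 gtr_pMr // invf_lt1 ?ltr0n // ltr1n.
have bigF : \bigcup_i `[0%R, c i]%classic = `[0%R, x[%classic.
  apply/seteqP; split => [t [i _]|t] /=; rewrite !in_itv/=.
    by move=> /andP[-> tc]/=; rewrite (le_lt_trans tc).
  move=> /andP[t0 tx]; have xt : 0 < x - t by rewrite subr_gt0.
  exists (Num.bound (x / (x - t))) => //=; rewrite in_itv/= t0/=.
  rewrite lerBrDr -lerBrDl ler_pdivrMr ?ltr0n // mulrC -ler_pdivrMr //.
  apply: (le_trans (ltW (archi_boundP _))); first by rewrite divr_ge0 ?ltW.
  by rewrite ler_nat; do 2 apply: leqW.
rewrite -bigF.
have lim1 : (\int[mu]_(t in `[0%R, c i]) ((x - t) `^ (b - 1))%:E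
    @[i --> \oo] --> (x `^ b / b)%:E)%E.
  under eq_fun do rewrite integral_powR_sub_trunc // cE.
  apply: cvg_EFin; first exact: nearW.
  rewrite -[X in _ --> X]subr0; apply: cvgB; first exact: cvg_cst.
  rewrite -[X in _ --> X](mul0r b^-1); apply: cvgMr_tmp.
  have/cvg_at_rightP := powR_cvg0 b0; apply; split => [i|]; first exact: xi.
  rewrite -[X in _ --> X](mulr0 x); apply: cvgMl_tmp.
  by have := @cvg_harmonic R; rewrite -cvg_shiftS.
apply/esym/(cvg_unique _ lim1) => //.
apply: (@ge0_nondecreasing_set_cvg_integral _ (measurableTypeR R) R
  (fun i => `[0%R, c i]%classic) _ (@lebesgue_measure R)).
- apply/nondecreasing_seqP => i; rewrite subsetEset; apply: subset_itvl.
  rewrite bnd_simp /c lerD2l lerN2 ler_pM2l // lef_pV2 ?posrE ?ltr0n //.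
  by rewrite ler_nat.
- by move=> i; exact: measurable_itv.
- by move=> i; apply/measurable_EFinP; exact: measurable_powR_sub.
- by move=> i t _; rewrite lee_fin powR_ge0.
Qed.

(** * Term by term integration of the kernel *)

Lemma norm_series_exp_coeff_le {y M : R} n :
  `|y| <= M -> `|series (exp_coeff y) n| <= expR M.
Proof.
move=> yM; have M0 : 0 <= M := le_trans (normr_ge0 y) yM.
apply: (@le_trans _ _ (series (exp_coeff M) n)).
  rewrite /series /=; apply: (le_trans (ler_norm_sum _ _ _)).
  apply: ler_sum => i _; rewrite /exp_coeff /= normrM normrX normfV.
  rewrite (ger0_norm (ler0n _ _)) ler_wpM2r ?invr_ge0 ?ler0n //.
  by rewrite lerXn2r ?nnegrE.
apply: nondecreasing_cvgn_le; last exact: is_cvg_series_exp_coeff.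
by apply: nondecreasing_series => i _ _; exact: exp_coeff_ge0.
Qed.

Lemma integrable_powR_sub {x b : R} : 0 < x -> 0 < b ->
  mu.-integrable `[0, x[ (EFin \o (fun t => (x - t) `^ (b - 1))).
Proof.
move=> x0 b0; apply/integrableP; split.
  by apply/measurable_EFinP; exact: measurable_powR_sub.
under eq_integral do rewrite /= ger0_norm ?powR_ge0 //.
by rewrite integral_powR_sub // ltry.
Qed.

(** Dominated convergence for the partial sums of the exponential series: on [[0, x[] every partial sum is at most
[exp (|a| x) (x - t)^(b - 1)] in absolute value. *)
Lemma expR_powR_integral_series {x b : R} (a : R) : 0 < x -> 0 < b ->
  mu.-integrable `[0, x[
    (EFin \o (fun t => expR (a * (x - t)) * (x - t) `^ (b - 1))) /\
  series (fun k : nat => a ^+ k / k`!%:R * (x `^ (b + k%:R) / (b + k%:R)))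
    @ \oo -->
  \int[mu]_(t in `[0, x[) (expR (a * (x - t)) * (x - t) `^ (b - 1)).
Proof.
move=> x0 b0.
have mJ : measurable (`[0%R, x[%classic : set (measurableTypeR R)).
  exact: measurable_itv.
pose K (t : R) := expR (a * (x - t)) * (x - t) `^ (b - 1).
pose u k (t : R) := a ^+ k / k`!%:R * (x - t) `^ (b + k%:R - 1).
have bk k : 0 < b + k%:R by rewrite ltr_pwDl.
have iu k : mu.-integrable `[0, x[ (EFin \o u k).
  by have := integrableZl mJ (a ^+ k / k`!%:R)
    (integrable_powR_sub x0 (bk k)).
have Iu k : (\int[mu]_(t in `[0%R, x[) (u k t)%:E =
    (a ^+ k / k`!%:R * (x `^ (b + k%:R) / (b + k%:R)))%:E)%E.
  have := integralZl mJ (integrable_powR_sub x0 (bk k))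
    (a ^+ k / k`!%:R).
  by rewrite integral_powR_sub.
have uE k t : t < x -> u k t = exp_coeff (a * (x - t)) k * (x - t) `^ (b - 1).
  move=> tx; have xt : 0 < x - t by rewrite subr_gt0.
  rewrite /u /exp_coeff /= exprMn (addrAC b).
  rewrite (powRD (r := b - 1)) ?powR_mulrn ?ltW //; first by ring.
  by rewrite (gt_eqF xt) implybT.
pose U n t : R := series (u ^~ t) n.
have UE n t : t < x ->
    U n t = series (exp_coeff (a * (x - t))) n * (x - t) `^ (b - 1).
  by move=> tx; rewrite /U /series /= mulr_suml; apply: eq_bigr => k _; exact: uE.
have mK : measurable_fun `[0%R, x[ K by exact: measurable_expR_powR_sub.
have mU n : measurable_fun `[0%R, x[ (U n).
  apply: measurable_sum => k; apply: measurable_funM => //.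
  exact: measurable_powR_sub.
have iG : mu.-integrable `[0, x[
    (EFin \o (fun t => expR (`|a| * x) * (x - t) `^ (b - 1))).
  by have := integrableZl mJ (expR (`|a| * x))
    (integrable_powR_sub x0 b0).
have [] := @dominated_convergence _ (measurableTypeR R) R mu `[0%R, x[%classic
  mJ (fun n => EFin \o U n) (EFin \o K) _ _ _ _ iG _.
- by move=> n; apply/measurable_EFinP; exact: mU.
- exact/measurable_EFinP.
- apply: aeW => t /=; rewrite in_itv/= => /andP[_ tx].
  apply: cvg_EFin; first exact: nearW.
  under eq_fun do rewrite UE //.
  by apply: cvgMr_tmp; exact: is_cvg_series_exp_coeff.
- apply: aeW => t n /=; rewrite in_itv/= => /andP[t0 tx].
  rewrite lee_fin UE // normrM [X in _ * X]ger0_norm ?powR_ge0 //.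
  rewrite ler_wpM2r ?powR_ge0 // norm_series_exp_coeff_le //.
  rewrite normrM ler_wpM2l // ger0_norm ?subr_ge0 ?(ltW tx) //.
  by rewrite gerBl.
move=> iK _ cvgU; split => //.
have IU n : (\int[mu]_(t in `[0%R, x[) (EFin \o U n) t)%E =
    (series (fun k => a ^+ k / k`!%:R * (x `^ (b + k%:R) / (b + k%:R))) n)%:E.
  rewrite /series /= -sumEFin.
  under eq_integral do rewrite /U /series /= -sumEFin.
  rewrite integral_sum //.
  by apply: eq_bigr => k _; rewrite Iu.
have fK : (\int[mu]_(t in `[0%R, x[) (EFin \o K) t)%E \is a fin_num.
  exact: integrable_fin_num.
rewrite -(fineK fK) in cvgU.
rewrite (_ : series _ = fine \o (fun n =>
    \int[mu]_(t in `[0%R, x[) (EFin \o U n) t)%E).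
  exact: fine_cvg.
by apply/funext => n /=; rewrite IU.
Qed.

(** * Fractional integrals as weighted integrals *)

Implicit Types (h u v w : R -> R) (alpha p x : R).

(** The factor of [gpf_integrand] in front of [h t], convertible with it.
It is studied on [[0, x[] because at [t = x] it is 0 for [alpha <> 1], so
that strict positivity fails there. *)
Definition gpf_kernel alpha p x (t : R) : R :=
  expR ((p - 1) / p * (x - t)) * (x - t) `^ (alpha - 1).

Lemma gpf_S_integral {alpha p x} : 0 < x -> 0 < alpha ->
  gpf_S alpha p x =
  (p `^ alpha * Gamma alpha)^-1 * \int[mu]_(t in `[0, x[) gpf_kernel alpha p x t.
Proof.
move=> x0 a0; congr (_ * _).
have [_] := expR_powR_integral_series ((p - 1) / p) x0 a0.
by move/cvg_lim; apply.
Qed.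

Lemma gpf_integrable_itvco {alpha p h x} : gpf_integrable alpha p h x ->
  mu.-integrable `[0, x[ (EFin \o (fun t => gpf_kernel alpha p x t * h t)).
Proof.
apply: integrableS => //.
exact: subset_itv_co_cc.
Qed.

Lemma gpf_int_itvco {alpha p h x} : gpf_integrable alpha p h x ->
  gpf_int alpha p h x = (p `^ alpha * Gamma alpha)^-1 *
    \int[mu]_(t in `[0, x[) (gpf_kernel alpha p x t * h t).
Proof.
move=> /gpf_integrable_itvco ih.
by rewrite /gpf_int -Rintegral_itv_bndo_bndc.
Qed.

Lemma Gamma_ge0 (s : R) : 0 <= Gamma s.
Proof. by apply: Rintegral_ge0 => t _; rewrite mulr_ge0 ?powR_ge0 ?expR_ge0. Qed.

Lemma gpf_kernel_gt0 {alpha p x t} : t < x -> 0 < gpf_kernel alpha p x t.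
Proof. by move=> tx; rewrite mulr_gt0 ?expR_gt0 ?powR_gt0 ?subr_gt0. Qed.

Lemma gpf_kernel_ge0 {alpha p x t} : 0 <= gpf_kernel alpha p x t.
Proof. by rewrite mulr_ge0 ?expR_ge0 ?powR_ge0. Qed.

Lemma gpf_kernel_integrable {alpha p x} : 0 < x -> 0 < alpha ->
  mu.-integrable `[0, x[ (EFin \o gpf_kernel alpha p x).
Proof. by move=> x0 a0; have [] := expR_powR_integral_series ((p - 1) / p) x0 a0. Qed.

Lemma measurable_gpf_kernel {alpha p x} {D : set R} :
  measurable_fun D (gpf_kernel alpha p x).
Proof. exact: measurable_expR_powR_sub. Qed.

Lemma gpf_sqr_integrable {alpha p u v w x} :
  measurable_fun `[0, x[ u ->
  (forall t, 0 <= t <= x -> 0 < v t /\ v t <= u t /\ u t <= w t) ->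
  gpf_integrable alpha p (fun t => (v t + w t) * u t) x ->
  mu.-integrable `[0, x[
    (EFin \o (fun t => gpf_kernel alpha p x t * (u t * u t))).
Proof.
move=> mu_ vuw iM.
have mJ : measurable (`[0%R, x[%classic : set (measurableTypeR R)).
  exact: measurable_itv.
have k0 t : `[0, x[%classic t -> 0 <= gpf_kernel alpha p x t.
  by move=> _; exact: gpf_kernel_ge0.
have vuwJ t : `[0, x[%classic t -> 0 <= v t /\ v t <= u t /\ u t <= w t.
  rewrite /= in_itv/= => /andP[t0 tx].
  by have [|v0 ?] := vuw t; [rewrite t0 ltW | split=> //; exact: ltW].
exact: (integrable_sqr_between mJ k0 measurable_gpf_kernel mu_ vuwJ
  (gpf_integrable_itvco iM)).
Qed.

(** [Rintegral_sqr_between] divided by [4 V], where [V], the integral of [v w]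
against the kernel, is positive because its integrand is. *)
Lemma weighted_cov_le_gpf_A {alpha p u v w x} : 0 < x -> 0 < alpha ->
  0 < (p `^ alpha * Gamma alpha)^-1 ->
  measurable_fun `[0, x[ u ->
  (forall t, 0 <= t <= x -> 0 < v t /\ v t <= u t /\ u t <= w t) ->
  gpf_integrable alpha p u x ->
  gpf_integrable alpha p (fun t => (v t + w t) * u t) x ->
  gpf_integrable alpha p (fun t => v t * w t) x ->
  (p `^ alpha * Gamma alpha)^-1 ^+ 2 *
    weighted_cov mu `[0, x[ (gpf_kernel alpha p x) u u
  <= gpf_A alpha p u v w x.
Proof.
move=> x0 a0 c0 mu_ vuw iu iM iV.
have mJ : measurable (`[0%R, x[%classic : set (measurableTypeR R)).
  exact: measurable_itv.
have k0 t : `[0, x[%classic t -> 0 < gpf_kernel alpha p x t.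
  by rewrite /= in_itv/= => /andP[_]; exact: gpf_kernel_gt0.
have vuwJ t : `[0, x[%classic t -> 0 < v t /\ v t <= u t /\ u t <= w t.
  by rewrite /= in_itv/= => /andP[t0 tx]; apply: vuw; rewrite t0 ltW.
have Puu := Rintegral_sqr_between mJ (fun t Jt => ltW (k0 t Jt))
  measurable_gpf_kernel mu_
  (fun t Jt => let: conj a b := vuwJ t Jt in conj (ltW a) b)
  (gpf_integrable_itvco iM) (gpf_integrable_itvco iV).
have V0 : 0 < \int[mu]_(t in `[0, x[) (gpf_kernel alpha p x t * (v t * w t)).
  have muJ : (0 < mu `[0%R, x[)%E.
    by rewrite lebesgue_measure_itv/= lte_fin x0 oppr0 adde0 lte_fin.
  apply: Rintegral_gt0 => //.
  - exact: gpf_integrable_itvco iV.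
  - move=> t Jt; have [v0 [vu uw]] := vuwJ t Jt.
    have w0 : 0 < w t := lt_le_trans v0 (le_trans vu uw).
    exact: mulr_gt0 (k0 t Jt) (mulr_gt0 v0 w0).
have S0 : 0 <= \int[mu]_(t in `[0, x[) gpf_kernel alpha p x t.
  by apply: Rintegral_ge0 => t /k0/ltW.
rewrite /gpf_A /weighted_cov gpf_S_integral // !gpf_int_itvco //.
move: Puu V0 S0 c0.
set P := (X in _ * X <= _); set V := (X in 4 * X * _ <= _).
set M := (X in _ <= X ^+ 2); set S := (X in _ -> _ -> 0 <= X -> _).
set F := (X in _ * (_ - X * _)); set c := (_ ^-1) => Puu V0 S0 c0.
have -> : c * S * ((c * M) ^+ 2 / (4 * (c * V))) - (c * F) ^+ 2 =
    c ^+ 2 * (S * (M ^+ 2 / (4 * V)) - F * F).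
  by field; rewrite !gt_eqF.
rewrite ler_wpM2l ?sqr_ge0 // lerB // ler_wpM2l //.
by rewrite ler_pdivlMr ?mulr_gt0 // mulrC.
Qed.

End kernel.

Theorem theorem3 (R : realType) (f g v1 v2 w1 w2 : R -> R) (x p1 alpha : R) (n : nat)
  (hf : pos_integrable f) (hg : pos_integrable g)
  (hx : 0 < x) (hp1 : 0 < p1 <= 1)
  (halpha : n%:R < alpha <= n.+1%:R)
  (hv1 : pos_integrable v1) (hv2 : pos_integrable v2)
  (hw1 : pos_integrable w1) (hw2 : pos_integrable w2)
  (hvf : forall t, 0 <= t <= x -> 0 < v1 t /\ v1 t <= f t /\ f t <= v2 t)
  (hwg : forall t, 0 <= t <= x -> 0 < w1 t /\ w1 t <= g t /\ g t <= w2 t)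
  (If : gpf_integrable alpha p1 f x)
  (Ig : gpf_integrable alpha p1 g x)
  (Ifg : gpf_integrable alpha p1 (fun t => f t * g t) x)
  (Ivf : gpf_integrable alpha p1 (fun t => (v1 t + v2 t) * f t) x)
  (Ivv : gpf_integrable alpha p1 (fun t => v1 t * v2 t) x)
  (Iwg : gpf_integrable alpha p1 (fun t => (w1 t + w2 t) * g t) x)
  (Iww : gpf_integrable alpha p1 (fun t => w1 t * w2 t) x) :
  `| gpf_S alpha p1 x * gpf_int alpha p1 (fun t => f t * g t) x
     - gpf_int alpha p1 f x * gpf_int alpha p1 g x |
  <= `| gpf_A alpha p1 f v1 v2 x * gpf_A alpha p1 g w1 w2 x | `^ (2^-1).
Proof.
have a0 : 0 < alpha by case/andP: halpha => na _; exact: le_lt_trans na.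
have mJ : measurable (`[0%R, x[%classic : set (measurableTypeR R)).
  exact: measurable_itv.
have mJ_of h : pos_integrable h -> measurable_fun `[0, x[ h.
  case=> _ /measurable_int /measurable_EFinP mh.
  apply: measurable_funS mh; first exact: measurable_itv.
  by move=> t /=; rewrite !in_itv/= => /andP[-> _].
have : 0 <= (p1 `^ alpha * Gamma alpha)^-1.
  by rewrite invr_ge0 mulr_ge0 ?powR_ge0 ?Gamma_ge0.
rewrite le_eqVlt => /predU1P[c0|c0].
  by rewrite gpf_S_integral // /gpf_int -c0 !mul0r subr0 normr0; exact: powR_ge0.
have Af := weighted_cov_le_gpf_A hx a0 c0 (mJ_of _ hf) hvf If Ivf Ivv.
have Ag := weighted_cov_le_gpf_A hx a0 c0 (mJ_of _ hg) hwg Ig Iwg Iww.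
have k0 t : `[0, x[%classic t -> 0 <= gpf_kernel alpha p1 x t.
  by move=> _; exact: gpf_kernel_ge0.
pose cov := weighted_cov (@lebesgue_measure R) `[0, x[ (gpf_kernel alpha p1 x).
have [ff0 gg0 CS] : [/\ 0 <= cov f f, 0 <= cov g g &
    cov f g ^+ 2 <= cov f f * cov g g].
  exact: (weighted_cov_CauchySchwarz mJ k0 (gpf_kernel_integrable hx a0)
    (gpf_integrable_itvco If) (gpf_integrable_itvco Ig)
    (gpf_integrable_itvco Ifg) (gpf_sqr_integrable (mJ_of _ hf) hvf Ivf)
    (gpf_sqr_integrable (mJ_of _ hg) hwg Iwg)).
rewrite powR12_sqrt // -sqrtr_sqr gpf_S_integral // !gpf_int_itvco //.
move: c0 Af Ag; set c := (_ ^-1) => c0 Af Ag.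
rewrite (_ : c * _ * _ - _ = c ^+ 2 * cov f g); last first.
  by rewrite /cov /weighted_cov; ring.
apply/ler_wsqrtr/(le_trans _ (ler_norm _)).
apply: (@le_trans _ _ ((c ^+ 2 * cov f f) * (c ^+ 2 * cov g g))).
  rewrite mulrACA exprMn -expr2.
  exact: ler_wpM2l (sqr_ge0 _) _ _ CS.
exact: (ler_pM (mulr_ge0 (sqr_ge0 c) ff0) (mulr_ge0 (sqr_ge0 c) gg0) Af Ag).
Qed.
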